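(* Let $\mathscr{A} = (Q,\Sigma,\delta)$ be an aperiodically $1$-contracting DFA with $n$ states, and let $W = \{w_1,\ldots,w_n\}\subseteq \Sigma^\star$ be a $1$-contracting collection for $\mathscr{A}$ for which the induced state map $\sigma_W$ is a cyclic permutation on $Q$. Then for every $k$ with $1\le k\le n$, every nonempty $k$-subset $S$ of $Q$ is reachable from $Q$ by a word $w_S$ of the form $w_S = w_{i_1}w_{i_2}\cdots w_{i_{n-k}}$ (a concatenation of $n-k$ words from $W$, with $i_1,\ldots,i_{n-k}\in\{1,\ldots,n\}$), i.e. $\delta(Q,w_S)=S$.
   Context: A DFA is $\mathscr{A}=(Q,\Sigma,\delta)$ with finite state set $Q$, finite alphabet $\Sigma$ and transition function $\delta:Q\times\Sigma\to Q$, extended to $Q\times\Sigma^\star$ in the usual way ($\delta(q,\varepsilon)=q$, $\delta(q,wa)=\delta(\delta(q,w),a)$), and to subsets by $\delta(S,w)=\{\delta(q,w)\mid q\in S\}$. A set $S\subseteq Q$ is reachable (from $Q$) by $w$ if $\delta(Q,w)=S$. For $q\in Q$ and $w\in\Sigma^\star$, $\delta^{-1}(q,w)=\{p\in Q\mid \delta(p,w)=q\}$. A word $w$ is a $1$-deficient word that excludes $q$ if $\delta(Q,w)=Q\setminus\{q\}$; such a word then has exactly one state $q^c$ with $|\delta^{-1}(q^c,w)|=2$, called its contracting state. A collection $W\subseteq\Sigma^\star$ is a $1$-contracting collection for $\mathscr{A}$ if for every $q\in Q$ it contains exactly one $1$-deficient word excluding $q$; $\mathscr{A}$ is $1$-contracting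 if such a collection exists. The state map induced by $W$ is $\sigma_W:Q\to Q$, where $\sigma_W(q)$ is the contracting state of the unique word in $W$ excluding $q$. $\mathscr{A}$ is aperiodically $1$-contracting if there is a $1$-contracting collection $W$ for which $\sigma_W$ is a cyclic permutation of $Q$ (i.e. $\sigma_W^n(q)=q$ and $\sigma_W^k(q)\ne q$ for $1\le k<n$, where $n=|Q|$). *)

(* Defs.v *)
From mathcomp Require Import all_boot.

Set Implicit Arguments.
Unset Strict Implicit.
Unset Printing Implicit Defensive.

Record dfa := DFA {
  state : finType;
  letter : finType;
  trans : state -> letter -> state
}.

Notation word A := (seq (letter A)).

Definition run (A : dfa) (q : state A) (w : word A) : state A :=
  foldl (@trans A) q w.

Definition run_set (A : dfa) (S : {set state A}) (w : word A) : {set state A} :=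
  [set run q w | q in S].

Definition run_inv (A : dfa) (q : state A) (w : word A) : {set state A} :=
  [set p | run p w == q].

Definition reachable_by (A : dfa) (S : {set state A}) (w : word A) : Prop :=
  run_set [set: state A] w = S.

(* [w] is a 1-deficient word that excludes [q]. *)
Definition excludes (A : dfa) (w : word A) (q : state A) : bool :=
  run_set [set: state A] w == [set: state A] :\ q.

(* The default [q0] is irrelevant when [w] is 1-deficient: see
   [contracting_state_unique] and [contracting_stateE]. *)
Definition contracting_state (A : dfa) (q0 : state A) (w : word A) : state A :=
  odflt q0 [pick q | #|run_inv q w| == 2].

Definition one_contracting_collection (A : dfa) (W : {pred word A}) : Prop :=
  forall q : state A, exists! w : word A, w \in W /\ excludes w q.

Lemma exists_excluding_word (A : dfa) (W : {pred word A}) (q : state A) :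
  one_contracting_collection W -> exists w : word A, (w \in W) && excludes w q.
Proof. by move=> /(_ q)[w [[wW wq] _]]; exists w; rewrite wW. Qed.

Definition excluding_word (A : dfa) (W : {pred word A})
    (hW : one_contracting_collection W) (q : state A) : word A :=
  xchoose (exists_excluding_word q hW).

Definition state_map (A : dfa) (W : {pred word A})
    (hW : one_contracting_collection W) (q : state A) : state A :=
  contracting_state q (excluding_word hW q).

Definition cyclic_permutation (Q : finType) (s : Q -> Q) : Prop :=
  forall q : Q, iter #|Q| s q = q /\
    (forall k : nat, 1 <= k < #|Q| -> iter k s q <> q).

Definition aperiodically_one_contracting (A : dfa) : Prop :=
  exists (W : {pred word A}) (hW : one_contracting_collection W),
    cyclic_permutation (state_map hW).

Lemma contracting_state_unique (A : dfa) (w : word A) (q : state A) :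
  excludes w q -> exists! c : state A, #|run_inv c w| = 2.
Proof.
move=> /eqP ex.
have q0 : #|run_inv q w| = 0.
  apply: eq_card0 => p; rewrite inE; apply/negP => /eqP rp.
  have : run p w \in run_set [set: state A] w by apply: imset_f; rewrite inE.
  by rewrite ex rp !inE eqxx.
have pos c : c != q -> 0 < #|run_inv c w|.
  move=> cq; have : c \in run_set [set: state A] w by rewrite ex !inE cq.
  by case/imsetP=> p _ ->; apply/card_gt0P; exists p; rewrite inE.
have tot : \sum_c #|run_inv c w| = #|state A|.
  rewrite -sum1_card [RHS](partition_big (fun p => run p w) predT) //=.
  by apply: eq_bigr => c _; rewrite -[LHS]sum1dep_card; apply: eq_bigl.
have /eqP/sum_nat_eq1[c [cq c1 cN]] : \sum_(c | c != q) (#|run_inv c w|).-1 = 1.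
  apply: (@addIn #|predC1 q|); rewrite -[X in _ + X = _](sum1_card (predC1 q)) -big_split /=.
  rewrite (eq_bigr (fun c => #|run_inv c w|)); last first.
    by move=> c /pos ?; rewrite addn1 prednK.
  by move: tot; rewrite (bigD1 q) //= q0 add0n => ->; rewrite cardC1 add1n prednK //; apply/card_gt0P; exists q.
exists c; split=> [|d d2]; first by rewrite -(prednK (pos c cq)) c1.
have [->//|dc] := eqVneq d c.
have dq : d != q by apply/eqP => dq; rewrite dq q0 in d2.
by have := cN d dc dq; rewrite d2.
Qed.

Lemma contracting_stateE (A : dfa) (w : word A) (q q0 : state A) :
  excludes w q -> #|run_inv (contracting_state q0 w) w| = 2.
Proof.
move=> /contracting_state_unique[c [c2 _]]; rewrite /contracting_state.
by case: pickP => [d /eqP //|/(_ c)]; rewrite c2.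
Qed.

Lemma state_mapE (A : dfa) (W : {pred word A})
    (hW : one_contracting_collection W) (w : word A) (q : state A) :
  w \in W -> excludes w q -> #|run_inv (state_map hW q) w| = 2.
Proof.
move=> wW wq; have /andP[uW uq] := xchooseP (exists_excluding_word q hW).
have [v [_ vU]] := hW q.
have <- : excluding_word hW q = w by rewrite -(vU w) // -(vU (excluding_word hW q)).
exact: contracting_stateE uq.
Qed.

(* Main.v *)
(** Pull [S] back one word at a time. Since the state map is a single cycle, any
    nonempty proper subset [S] misses some [q] whose image under the state map
    lies in [S]. The preimage of [S] under the word of [W] excluding [q] then has
    exactly one more state than [S] and is mapped onto [S]; iterating reaches the
    full state set after [n - k] steps. *)
Require Import Defs.
From mathcomp Require Import all_boot.

(** The first [#|Q|] iterates of [x] are pairwise distinct, so by counting they exhaust [Q]. *)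
Lemma cyclic_permutation_transitive (Q : finType) (s : Q -> Q) (x y : Q) :
  cyclic_permutation s -> exists k, y = iter k s x.
Proof.
move=> /(_ x)[sx sN]; pose f (i : 'I_#|Q|) := iter i s x.
have Nlt (i j : 'I_#|Q|) : i < j -> f i <> f j.
  (* Applying [s] another [#|Q| - j] times to [f i = f j] turns the right side into [x], so [x]
     would return too early. *)
  move=> ij fij; apply: (sN (#|Q| - j + i)).
    by rewrite ltn_addr ?subn_gt0 //= -[ltnRHS](subnK (ltnW (ltn_ord j))) ltn_add2l.
  by rewrite iterD -/(f i) fij -iterD subnK ?sx // ltnW.
have f_inj : injective f.
  by move=> i j fij; apply: val_inj; case: (ltngtP i j) => // /Nlt; rewrite fij.
have /codomP[i ->] : y \in codom f by apply: inj_card_onto; rewrite ?card_ord.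
by exists i.
Qed.

(** Otherwise the complement of [S] would be closed under [s], and the orbit of a state outside [S]
    could never reach [S]. *)
Lemma cyclic_permutation_enters (Q : finType) (s : Q -> Q) (S : {set Q}) :
  cyclic_permutation s -> S != set0 -> S != setT ->
  exists2 q, q \notin S & s q \in S.
Proof.
move=> s_cyc /set0Pn[y yS] ST.
have [x xS] : exists x, x \notin S.
  by move: ST; rewrite -subTset => /subsetPn[x _]; exists x.
have [/exists_inP //|] := boolP [exists (q | q \notin S), s q \in S].
move=> /exists_inPn sN; have [k yE] := cyclic_permutation_transitive _ _ x y s_cyc.
have iter_notin m : iter m s x \notin S by elim: m => //= m; apply: sN.
by case/negP: (iter_notin k); rewrite -yE.
Qed.

Lemma run_set_cat (A : dfa) (S : {set state A}) (u v : word A) :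
  run_set S (u ++ v) = run_set (run_set S u) v.
Proof.
rewrite /run_set -imset_comp; apply: eq_imset => q /=.
by rewrite /run foldl_cat.
Qed.

(** Only [q] lacks a preimage under [w], so every state of [S] is hit. *)
Lemma run_set_preim (A : dfa) (S : {set state A}) (w : word A) (q : state A) :
  excludes w q -> q \notin S -> run_set [set p | run p w \in S] w = S.
Proof.
move=> /eqP wq qS; apply/setP=> y; apply/imsetP/idP => [[p]|yS].
  by rewrite inE => pS ->.
have : y \in [set: state A] :\ q.
  by rewrite !inE andbT; apply: contraNneq qS => <-.
by rewrite -wq => /imsetP[p _ yp]; exists p; rewrite // inE -yp.
Qed.

(** The word [w] merges only the two states over [c]; without one of them, the preimage of [S] is in
    bijection with [S]. *)
Lemma card_preim_excludes (A : dfa) (S : {set state A}) (w : word A)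
    (q c : state A) :
  excludes w q -> #|run_inv c w| = 2 -> q \notin S -> c \in S ->
  #|[set p | run p w \in S]| = #|S|.+1.
Proof.
move=> wq /eqP/cards2P[p1 [p2 [p12 cE]]] qS cS.
have [p1c p2c] : run p1 w = c /\ run p2 w = c.
  have fib p : (run p w == c) = (p \in [set p1; p2]) by rewrite -cE inE.
  by split; apply/eqP; rewrite fib !inE eqxx ?orbT.
(* Dropping one of the two states merged by [w] does not change images. *)
have imD1 (T : {set state A}) : p2 \in T -> run_set (T :\ p1) w = run_set T w.
  move=> p2T; apply/eqP; rewrite eqEsubset imsetS ?subsetDl //=.
  apply/subsetP=> _ /imsetP[p pT ->]; have [->|pp1] := eqVneq p p1.
    by rewrite p1c -p2c imset_f // !inE eq_sym p12.
  by rewrite imset_f // !inE pp1.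
(* Injectivity by counting: the domain omits only [p1], its image only [q]. *)
have w_inj : {in [set: state A] :\ p1 &, injective (fun p => run p w)}.
  apply/imset_injP; move: (imD1 setT (in_setT _)); rewrite (eqP wq) /run_set => ->.
  by rewrite !cardsDS ?sub1set ?inE // !cards1.
set T := [set p | _].
have p1T : p1 \in T by rewrite inE p1c.
have p2T : p2 \in T by rewrite inE p2c.
rewrite (cardsD1 p1) p1T -(run_set_preim _ S w q wq qS) -/T -(imD1 T p2T).
rewrite card_in_imset // => x y /setD1P[xp _] /setD1P[yp _].
by apply: w_inj; rewrite !inE ?xp ?yp.
Qed.

Lemma reachable_by_collection (A : dfa) (n : nat) (W : n.-tuple (word A))
    (hW : one_contracting_collection [in W]) (m : nat) (S : {set state A}) :
  cyclic_permutation (state_map hW) -> S != set0 -> #|S| + m = #|state A| ->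
  exists i : m.-tuple 'I_n,
    reachable_by S (flatten [seq tnth W j | j <- i]).
Proof.
move=> s_cyc; elim: m S => [|m IHm] S S0 Sm.
  exists [tuple]; rewrite /reachable_by /run_set /= imset_id; apply/esym/eqP.
  by rewrite eqEcard subsetT cardsT -Sm addn0 leqnn.
have ST : S != setT.
  by apply/eqP => SE; move: Sm; rewrite SE cardsT -[RHS]addn0 => /addnI.
have [q qS sqS] := cyclic_permutation_enters _ _ _ s_cyc S0 ST.
have /andP[wW wq] := xchooseP (exists_excluding_word q hW).
have w2 := state_mapE hW wW wq.
move: wW wq w2; set w := xchoose _ => /tnthP[j wE] wq w2.
have TS := card_preim_excludes _ S w q _ wq w2 qS sqS.
have [||i iT] := IHm [set p | run p w \in S].
- by rewrite -card_gt0 TS.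
- by rewrite TS addSnnS.
(* The word reaching the preimage is read first, so [w] is appended at the end. *)
exists [tuple of rcons i j]; rewrite /reachable_by /= map_rcons flatten_rcons.
by rewrite run_set_cat iT -wE; apply: run_set_preim wq qS.
Qed.

Theorem theorem1 (A : dfa) (n : nat) (W : n.-tuple (word A))
    (hW : one_contracting_collection [in W]) :
  #|state A| = n ->
  aperiodically_one_contracting A ->
  cyclic_permutation (state_map hW) ->
  forall k : nat, 1 <= k <= n ->
  forall S : {set state A}, S != set0 -> #|S| = k ->
  exists i : (n - k).-tuple 'I_n,
    reachable_by S (flatten [seq tnth W j | j <- i]).
Proof.
move=> An _ s_cyc k /andP[_ kn] S S0 Sk.
by apply: (reachable_by_collection _ _ _ hW) => //; rewrite Sk An subnKC.
Qed.
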